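(* Let $(\bar x,\bar\lambda)=(\bar x^1,\dots,\bar x^N,\bar\lambda^1,\dots,\bar\lambda^N)\in S_{\rm KKT}(\bar p)$, $\bar p=(\bar u,\bar v,\bar w)$. The following are equivalent: (i) $S_{\rm KKT}$ is isolated calm at $\bar p$ for $(\bar x,\bar\lambda)$; (ii) $T_{\rm KKT}$ is isolated calm at $(\bar u,\bar v)$ for $(\bar x,\bar\lambda)$.
   Context: Nash equilibrium problem (NEP) with canonical perturbations. There are $N$ players; player $k$ has strategy $x^k\in\mathbb R^{n_k}$; $x=(x^1,\dots,x^N)\in\mathbb R^n$, $n=n_1+\cdots+n_N$; $x^{-k}$ denotes the other players' strategies. Parameters: $p^k=(u^k,v^k,w^k)\in\mathbb R^{m_k}\times\mathbb R^{n_k}\times\mathbb R^{d_k}$, $p=(p^1,\dots,p^N)$, identified with $(u,v,w)\in\mathbb R^{m}\times\mathbb R^n\times\mathbb R^d$, $m=\sum m_k$, $d=\sum d_k$. Given $x^{-k},p^k$, player $k$ solves $$\min_{x^k}\ f^k(x^k,x^{-k};w^k)-\langle v^k,x^k\rangle\ \text{ s.t. } g^k_i(x^k;w^k)=u^k_i\ (i=1,\dots,s_k),\ \ g^k_j(x^k;w^k)\le u^k_j\ (j=s_k+1,\dots,m_k),$$ with $f^k\in C^2(\mathbb R^n\times\mathbb R^{d_k})$, $g^k_i\in C^2(\mathbb R^{n_k}\times\mathbb R^{d_k})$. Lagrangian: $L^k(x^k,x^{-k},\lambda^k;w^k)=f^k(x^k,x^{-k};w^k)+\sum_{i=1}^{m_k}\lambda^k_ig^k_i(x^k;w^k)$.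 KKT mapping: $S_{\rm KKT}(p)$ is the set of $(x,\lambda)\in\mathbb R^n\times\mathbb R^m$ such that for each $k$: $v^k=\nabla_{x^k}L^k(x^k,x^{-k},\lambda^k;w^k)$; $g^k_i(x^k;w^k)=u^k_i$ for $i\le s_k$; and $\lambda^k_j\ge0$, $g^k_j(x^k;w^k)\le u^k_j$, $\lambda^k_j(g^k_j(x^k;w^k)-u^k_j)=0$ for $j>s_k$. The KKT mapping with only tilt perturbations is $T_{\rm KKT}(u,v):=S_{\rm KKT}(u,v,\bar w)$, with $\bar w$ the $w$-component of $\bar p$. A set-valued mapping $\Phi$ is isolated calm at $\bar a$ for $\bar b$ if $\bar b\in\Phi(\bar a)$ and there are $\kappa\ge0$ and open neighborhoods $U$ of $\bar a$, $V$ of $\bar b$ with $\Phi(a)\cap V\subset\{\bar b\}+\kappa\|a-\bar a\|\mathbb B$ for all $a\in U$, where $\mathbb B$ is the unit ball. *)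

(* Defs.v *)
From mathcomp Require Import all_boot all_order all_algebra.
From mathcomp Require Import all_classical all_reals all_analysis.

Set Implicit Arguments.
Unset Strict Implicit.
Unset Printing Implicit Defensive.

Import Order.TTheory GRing.Theory Num.Theory.
Import numFieldNormedType.Exports.

Local Open Scope classical_set_scope.
Local Open Scope ring_scope.

(* V is only ever a product of spaces 'rV[R]_n: in finite dimension, continuity
   of x |-> 'd f x is the same as continuity of x |-> 'D_v f x for every v. *)
Definition C1 (R : realType) (V : normedModType R) (f : V -> R) : Prop :=
  (forall x, differentiable f x) /\ (forall v, continuous ('D_v f)).

Definition C2 (R : realType) (V : normedModType R) (f : V -> R) : Prop :=
  C1 f /\ (forall v, C1 ('D_v f)).

Definition gradient (R : realType) (n : nat) (h : 'rV[R]_n -> R)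
    (x : 'rV[R]_n) : 'rV[R]_n :=
  \row_j 'D_(delta_mx 0 j) h x.

(* The norms are those of the library, i.e. the max norm on 'rV[R]_n and on
   products; on finite-dimensional spaces the choice of norms only affects the
   constant kappa. The image set is {bbar} + kappa * `|a - abar| * B, with B the
   closed unit ball. *)
Definition isolated_calm (R : realType) (A B : normedModType R)
    (Phi : A -> set B) (abar : A) (bbar : B) : Prop :=
  Phi abar bbar /\
  exists (kappa : R) (U : set A) (V : set B),
    [/\ 0 <= kappa, open U /\ U abar, open V /\ V bbar &
      forall a, U a ->
        Phi a `&` V `<=`
          [set bbar + (kappa * `|a - abar|) *: e | e in [set e : B | `|e| <= 1]]].

(* Vectors of R^n, n = n_1 + ... + n_N, are row vectors of size
   \sum_k n_k; their k-th block is obtained with submxrow. The constraints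
   of player k with index i < num_eq k are equalities, the others inequalities. *)
Record nep (R : realType) := NEP {
  players : nat;
  dimx : 'I_players -> nat;
  dimu : 'I_players -> nat;
  dimw : 'I_players -> nat;
  num_eq : 'I_players -> nat;
  obj : forall k, 'rV[R]_(\sum_l dimx l) * 'rV[R]_(dimw k) -> R;
  cstr : forall k, 'I_(dimu k) -> 'rV[R]_(dimx k) * 'rV[R]_(dimw k) -> R;
  num_eq_le : forall k, (num_eq k <= dimu k)%N;
  obj_C2 : forall k, C2 (@obj k);
  cstr_C2 : forall k i, C2 (@cstr k i) }.

Section KKT.
Variables (R : realType) (G : nep R).

Local Notation strategies := 'rV[R]_(\sum_k @dimx R G k).
Local Notation multipliers := 'rV[R]_(\sum_k @dimu R G k).
Local Notation paramu := 'rV[R]_(\sum_k @dimu R G k).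
Local Notation paramv := 'rV[R]_(\sum_k @dimx R G k).
Local Notation paramw := 'rV[R]_(\sum_k @dimw R G k).

(* (y, x^{-k}): the profile x with the strategy of player k replaced by y *)
Definition deviate (k : 'I_(players G)) (x : strategies)
    (y : 'rV[R]_(dimx k)) : strategies :=
  \mxrow_l dfwith (fun l => submxrow x l) k y l.

Definition lagrangian (k : 'I_(players G)) (x : strategies)
    (lam : 'rV[R]_(dimu k)) (w : 'rV[R]_(dimw k)) : R :=
  obj (x, w) + \sum_i lam 0 i * cstr i (submxrow x k, w).

Definition grad_lagrangian (k : 'I_(players G)) (x : strategies)
    (lam : 'rV[R]_(dimu k)) (w : 'rV[R]_(dimw k)) : 'rV[R]_(dimx k) :=
  gradient (fun y => lagrangian (deviate x y) lam w) (submxrow x k).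

Definition SKKT (p : paramu * paramv * paramw) :
    set (strategies * multipliers) :=
  let: (u, v, w) := p in
  [set z | let: (x, lam) := z in
    forall k : 'I_(players G),
      let xk := submxrow x k in
      let lamk := submxrow lam k in
      let uk := submxrow u k in
      let vk := submxrow v k in
      let wk := submxrow w k in
      [/\ vk = grad_lagrangian x lamk wk,
          forall i : 'I_(dimu k), (i < num_eq k)%N ->
            cstr i (xk, wk) = uk 0 i &
          forall j : 'I_(dimu k), (num_eq k <= j)%N ->
            [/\ 0 <= lamk 0 j, cstr j (xk, wk) <= uk 0 j &
                lamk 0 j * (cstr j (xk, wk) - uk 0 j) = 0]]].

Definition TKKT (wbar : paramw) (q : paramu * paramv) :
    set (strategies * multipliers) :=
  SKKT (q.1, q.2, wbar).

End KKT.

(* Main.v *)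
(* The tilt parameters (u, v) enter the KKT system additively. Hence a KKT point
   (x, lambda) for (u, v, w) is a KKT point for (u', v', wbar), with
   u' = u + g(x; wbar) - g(x; w) and
   v' = v + grad L(x, lambda; wbar) - grad L(x, lambda; w).
   As the data are C^2, g and grad L are Lipschitz in w, uniformly in (x, lambda)
   near the reference point, so |(u', v') - (ubar, vbar)| is at most a constant
   times |(u, v, w) - (ubar, vbar, wbar)|. Thus calmness of T_KKT gives calmness
   of S_KKT; the converse is the restriction to w = wbar. *)
Require Import Defs.
From mathcomp Require Import all_boot all_order all_algebra.
From mathcomp Require Import all_classical all_reals all_analysis.

Set Implicit Arguments.
Unset Strict Implicit.
Unset Printing Implicit Defensive.

Import Order.TTheory GRing.Theory Num.Theory.
Import numFieldNormedType.Exports.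

Local Open Scope classical_set_scope.
Local Open Scope ring_scope.

(** * Directional derivatives along affine maps, and max-norm bounds *)

Lemma is_derive_comp_affine (R : numFieldType) (V' V W : normedModType R)
    (f : V -> W) (g : V' -> V) (x v : V') (u : V) :
  (forall h : R, g (h *: v + x) = h *: u + g x) -> derivable f (g x) u ->
  is_derive x v (f \o g) ('D_u f (g x)).
Proof.
move=> gE df.
(* Both difference quotients are the same function of [h], so derivability and the value of the
   derivative transfer together. *)
have E : (fun h : R => h^-1 *: (((f \o g) \o shift x) (h *: v) - (f \o g) x)) =
         (fun h : R => h^-1 *: ((f \o shift (g x)) (h *: u) - f (g x))).
  by apply/funext => h /=; rewrite gE.
by constructor; rewrite /derivable /derive E.
Qed.

Lemma norm_coord_le (R : realDomainType) (m n : nat) (A : 'M[R]_(m, n)) i j :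
  `|A i j| <= mx_norm A.
Proof.
by rewrite mx_normrE (le_bigmax _ (fun ij => `|A ij.1 ij.2|) (i, j)).
Qed.

Lemma mx_norm_le (R : realDomainType) (m n : nat) (A : 'M[R]_(m, n)) (c : R) :
  0 <= c -> (forall i j, `|A i j| <= c) -> mx_norm A <= c.
Proof. by move=> c0 Ac; rewrite mx_normrE; apply/bigmax_leP; split. Qed.

Lemma norm_submxrow_le (R : realType) (q : nat) (q_ : 'I_q -> nat)
    (A : 'rV[R]_(\sum_i q_ i)) (k : 'I_q) : `|submxrow A k| <= `|A|.
Proof. by apply: mx_norm_le => // i j; rewrite mxE norm_coord_le. Qed.

(** * Calmness in one variable, uniform in the other: closure rules and the C1 case *)

Section UnifCalm.
Variable R : realType.

(* F z is calm in w at w0, with a constant and a neighborhood of w0 that do not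
   depend on z near z0. *)
Definition unif_calm (Z W : normedModType R) (F : Z -> W -> R) (z0 : Z)
    (w0 : W) : Prop :=
  exists C : R, \forall p \near (z0, w0),
    `|F p.1 p.2 - F p.1 w0| <= C * `|p.2 - w0|.

Lemma unif_calmD (Z W : normedModType R) (F G : Z -> W -> R) z0 w0 :
  unif_calm F z0 w0 -> unif_calm G z0 w0 ->
  unif_calm (fun z w => F z w + G z w) z0 w0.
Proof.
move=> [C FC] [D GD]; exists (C + D); near=> p.
rewrite opprD addrACA mulrDl (le_trans (ler_normD _ _))// lerD//.
  by near: p.
by near: p.
Unshelve. all: by end_near. Qed.

Lemma unif_calm_sum (Z W : normedModType R) (n : nat)
    (F : 'I_n -> Z -> W -> R) z0 w0 :
  (forall i, unif_calm (F i) z0 w0) ->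
  unif_calm (fun z w => \sum_i F i z w) z0 w0.
Proof.
elim: n F => [F _|n IH F hF].
  by exists 0; near=> p; rewrite !big_ord0 subr0 normr0 mul0r.
rewrite (_ : (fun z w => _) = (fun z w => F ord0 z w +
    \sum_(i < n) F (lift ord0 i) z w)); last first.
  by apply/funext => z; apply/funext => w; rewrite big_ord_recl.
by apply: unif_calmD => //; exact: IH.
Unshelve. all: by end_near. Qed.

Lemma near_le_norm_add1 (V W : normedModType R) (h : V -> W) z0 :
  {for z0, continuous h} -> \forall z \near z0, `|h z| <= `|h z0| + 1.
Proof.
move=> /cvgrPdist_lt /(_ 1 ltr01); apply: filterS => z hz.
rewrite -[h z](subrK (h z0)) addrC (le_trans (ler_normD _ _))// lerD2l.
by rewrite distrC ltW.
Qed.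

(** Continuity bounds [h] near [z0] by [|h z0| + 1], so the factor only enlarges the constant. *)
Lemma unif_calmM (Z W : normedModType R) (h : Z -> R) (F : Z -> W -> R) z0 w0 :
  {for z0, continuous h} -> unif_calm F z0 w0 ->
  unif_calm (fun z w => h z * F z w) z0 w0.
Proof.
move=> /near_le_norm_add1 hb [C FC]; exists ((`|h z0| + 1) * C).
have hb' : \forall p \near (z0, w0), `|h p.1| <= `|h z0| + 1.
  exact: (cvg_fst hb).
near=> p; rewrite -mulrBr normrM -mulrA ler_pM//.
  by near: p.
by near: p.
Unshelve. all: by end_near. Qed.

Lemma nonexpansive_continuous_at (V W : normedModType R) (f : V -> W) x :
  (forall y, `|f y - f x| <= `|y - x|) -> {for x, continuous f}.
Proof.
move=> fle; apply/cvgrPdist_lt => e e0; apply/nbhs_normP; exists e => //= y xy.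
by rewrite distrC (le_lt_trans (fle y))// distrC.
Qed.

Lemma unif_calm_comp (Z W Z' W' : normedModType R) (F : Z' -> W' -> R)
    (phi : Z -> Z') (psi : W -> W') z0 w0 :
  {for z0, continuous phi} -> (forall w, `|psi w - psi w0| <= `|w - w0|) ->
  unif_calm F (phi z0) (psi w0) ->
  unif_calm (fun z w => F (phi z) (psi w)) z0 w0.
Proof.
(* The sign of [C] is unknown; replacing it by [|C|] lets the bound on [psi] be multiplied
   through. *)
move=> cphi lpsi [C FC]; exists `|C|.
have cpsi := nonexpansive_continuous_at lpsi.
have cpq : (phi p.1, psi p.2) @[p --> (z0, w0)] --> (phi z0, psi w0).
  apply: cvg_pair.
    apply: (@cvg_comp _ _ _ fst phi _ (nbhs z0)); [exact: cvg_fst|exact: cphi].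
  apply: (@cvg_comp _ _ _ snd psi _ (nbhs w0)); [exact: cvg_snd|exact: cpsi].
have FC' : \forall p \near (z0, w0), `|F (phi p.1) (psi p.2) -
    F (phi p.1) (psi w0)| <= C * `|psi p.2 - psi w0| by exact: (cpq _ FC).
near=> p.
rewrite (@le_trans _ _ (C * `|psi p.2 - psi w0|))//; first by near: p.
rewrite (@le_trans _ _ (`|C| * `|psi p.2 - psi w0|))//.
  by rewrite ler_wpM2r ?ler_norm.
by rewrite ler_wpM2l.
Unshelve. all: by end_near. Qed.

(** Finitely many neighborhoods intersect in a neighborhood, and the sum of the [|C i|] dominates
    each constant. The product carries the max norm, so one radius serves both variables. *)
Lemma unif_calm_uniform (Z W : normedModType R) (I : finType)
    (F : I -> Z -> W -> R) z0 w0 :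
  (forall i, unif_calm (F i) z0 w0) ->
  exists C r : R, [/\ 0 <= C, 0 < r & forall z w, `|z - z0| < r ->
    `|w - w0| < r -> forall i, `|F i z w - F i z w0| <= C * `|w - w0|].
Proof.
move=> /choice[C FC].
have : \forall p \near (z0, w0), forall i,
    `|F i p.1 p.2 - F i p.1 w0| <= (\sum_i `|C i|) * `|p.2 - w0|.
  apply: (@filter_forall _ _ _ (nbhs (z0, w0))) => i; have {}FC := FC i; near=> p.
  rewrite (@le_trans _ _ (C i * `|p.2 - w0|))//; first by near: p.
  rewrite ler_wpM2r// (bigD1 i)//= (le_trans (ler_norm _))// lerDl.
  exact: sumr_ge0.
move=> /nbhs_normP[r /= r0 rP]; exists (\sum_i `|C i|), r.
split=> // [|z w zr wr i]; first exact: sumr_ge0.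
by apply: (rP (z, w)); rewrite /= prod_normE gt_max/= (distrC z0) zr distrC.
Unshelve. all: by end_near. Qed.

(** Mean value theorem on the segment from [(x, b)] to [(x, w)]: the derivative along [(0, w - b)]
    is a combination of the partial derivatives in the second variable, which are locally bounded by
    continuity. *)
Lemma C1_unif_calm (n m : nat) (f : 'rV[R]_n * 'rV[R]_m -> R) a b :
  C1 f -> unif_calm (fun x w => f (x, w)) a b.
Proof.
move=> [df cdf].
pose e j : 'rV[R]_n * 'rV[R]_m := (0, delta_mx 0 j).
pose M j := `|'D_(e j) f (a, b)| + 1.
have : \forall p \near (a, b), forall j, `|'D_(e j) f p| <= M j.
  by apply: (@filter_forall _ _ _ (nbhs (a, b))) => j;
    exact: (near_le_norm_add1 (cdf (e j) (a, b))).
move=> /nbhs_normP[r /= r0 rM].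
exists (\sum_j M j); apply/nbhs_normP; exists r => //= -[x w] xw /=.
set v := w - b.
pose g (t : R^o) : 'rV[R]_n * 'rV[R]_m := (x, b + t *: v).
have gd (t : R^o) : is_derive t 1 (f \o g) ('D_(0, v) f (g t)).
  apply: is_derive_comp_affine; last exact/diff_derivable/df.
  move=> h; rewrite /g; congr pair => /=; first by rewrite scaler0 add0r.
  by rewrite scalerDl addrCA; congr (_ *: _ + _); rewrite /GRing.scale/= mulr1.
have cg : {within `[0, 1], continuous (f \o g)}.
  apply: continuous_subspaceT => t; apply: differentiable_continuous.
  by apply/derivable1_diffP; case: (gd t).
have [c c01] := MVT_segment ler01 (fun t _ => gd t) cg.
rewrite /g /= scale1r scale0r addr0 subr0 mulr1 [b + v]addrC subrK => ->.
rewrite deriveE; last exact: df.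
(* Expanding [v] in the canonical basis reduces the estimate to the directions [e j], where the
   bounds [M j] hold. *)
have -> : ((0, v) : 'rV[R]_n * 'rV[R]_m) = \sum_j v 0 j *: e j.
  apply/pair_eqP/andP; split; apply/eqP => /=.
    rewrite (big_morph fst (id1 := 0) (op1 := +%R))// big1// => j _.
    by rewrite /= scaler0.
  by rewrite (big_morph snd (id1 := 0) (op1 := +%R))// {1}[v]row_sum_delta.
rewrite linear_sum (le_trans (ler_norm_sum _ _ _))// mulr_suml ler_sum// => j _.
rewrite linearZ normrM mulrC ler_pM//; last exact: norm_coord_le.
rewrite -deriveE; last exact: df.
(* The intermediate point stays in the ball: its first component is [x], and its second is at
   distance [c * |v| <= |w - b|] from [b]. *)
apply: rM; move: xw; rewrite /= !prod_normE !gt_max /= => /andP[-> bw] /=.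
have /andP[c0 c1] : 0 <= c <= 1 by rewrite in_itv in c01.
rewrite opprD addNKr normrN normrZ ger0_norm// (le_lt_trans _ bw)// distrC.
by rewrite ler_piMl.
Qed.

End UnifCalm.

Lemma closed_ball_imageE (R : realType) (B : normedModType R) (b z : B) (c : R) :
  0 <= c ->
  [set b + c *: e | e in [set e : B | `|e| <= 1]] z <-> `|z - b| <= c.
Proof.
move=> c0; split => [[e /= e1 <-]|zc].
  by rewrite addrC addKr normrZ ger0_norm// ler_piMr.
(* For [c = 0] the ball is a single point and [e = 0] works; otherwise [e] is [z - b] divided by
   [c]. *)
have [c00|cn0] := eqVneq c 0.
  exists 0; first by rewrite /= normr0.
  move: zc; rewrite c00 normr_le0 subr_eq0 => /eqP ->.
  by rewrite scaler0 addr0.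
exists (c^-1 *: (z - b)); last by rewrite scalerA divff// scale1r addrC subrK.
have cp : 0 < c by rewrite lt0r cn0.
by rewrite /= normrZ ger0_norm ?invr_ge0// mulrC ler_pdivrMr ?mul1r.
Qed.

(** * The gradient of the Lagrangian in terms of derivatives of the data *)

Section GradLagrangian.
Variables (R : realType) (G : nep R) (k : 'I_(players G)).
Local Notation strategies := 'rV[R]_(\sum_k @dimx R G k).
Implicit Types (x : strategies) (y : 'rV[R]_(dimx k)).

Lemma submxrow_deviate x y : submxrow (deviate x y) k = y.
Proof. by rewrite /deviate mxrowK dfwithin. Qed.

(** Replacing the block of player [k] is affine with linear part [deviate 0]; this identifies the
    direction in which [obj] is differentiated. *)
Lemma deviate_affine x y (h : R) :
  deviate x (h *: y + submxrow x k) = h *: deviate 0 y + x.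
Proof.
apply/mxrowP => l; rewrite submxrowD.
rewrite (_ : submxrow (h *: _) l = h *: submxrow (deviate 0 y) l); last first.
  by apply/matrixP => i j; rewrite !mxE.
rewrite /deviate !mxrowK; have [<-|kl] := eqVneq k l.
  by rewrite !dfwithin.
by rewrite !dfwithout// submxrow0 scaler0 add0r.
Qed.

Lemma grad_lagrangianE x (lam : 'rV[R]_(dimu k)) (w : 'rV[R]_(dimw k)) j :
  grad_lagrangian x lam w 0 j =
  'D_(deviate 0 (delta_mx 0 j), 0) (@obj R G k) (x, w) +
  \sum_i lam 0 i * 'D_(delta_mx 0 j, 0) (cstr i) (submxrow x k, w).
Proof.
rewrite /grad_lagrangian /gradient mxE.
set e := delta_mx 0 j.
have dobj : is_derive (submxrow x k) e
    (@obj R G k \o (fun y => (deviate x y, w)))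
    ('D_(deviate 0 e, 0) (@obj R G k) (x, w)).
  (* The affine formula with step [h = 0]. *)
  have E : deviate x (submxrow x k) = x.
    by have := deviate_affine x 0 0; rewrite !scale0r !add0r.
  have := @is_derive_comp_affine R _ _ _ (@obj R G k)
    (fun y => (deviate x y, w)) (submxrow x k) e (deviate 0 e, 0).
  rewrite /= E; apply; last exact/diff_derivable/(obj_C2 k).1.1.
  by move=> h; rewrite deviate_affine; congr pair; rewrite /= scaler0 add0r.
have dcstr i : is_derive (submxrow x k) e (cstr i \o (fun y => (y, w)))
    ('D_(e, 0) (cstr i) (submxrow x k, w)).
  apply: is_derive_comp_affine.
    by move=> h; congr pair; rewrite /= scaler0 add0r.
  exact/diff_derivable/(cstr_C2 i).1.1.
(* In this shape the derivative is inferred from [dobj] and [dcstr] by the sum and scaling rules. *)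
rewrite (_ : (fun y => _) = (@obj R G k \o (fun y => (deviate x y, w))) +
  \sum_i (lam 0 i \*: (cstr i \o (fun y => (y, w))))).
  exact: derive_val.
apply/funext => y; rewrite /lagrangian submxrow_deviate fctE.
by rewrite fct_sumE.
Qed.

End GradLagrangian.

Lemma continuous_submxrow (R : realType) (q : nat) (q_ : 'I_q -> nat)
    (k : 'I_q) :
  continuous (fun A : 'rV[R]_(\sum_i q_ i) => submxrow A k).
Proof.
move=> A; apply: nonexpansive_continuous_at => B.
by rewrite -submxrowB norm_submxrow_le.
Qed.

(** * Uniform calmness in [w] of the functions in the KKT system *)

Section Data.
Variables (R : realType) (G : nep R).
Local Notation strategies := 'rV[R]_(\sum_k @dimx R G k).
Local Notation multipliers := 'rV[R]_(\sum_k @dimu R G k).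
Local Notation paramw := 'rV[R]_(\sum_k @dimw R G k).
Variables (z0 : strategies * multipliers) (w0 : paramw).

Lemma block_unif_calm (Z : normedModType R) (k : 'I_(players G)) n
    (f : 'rV[R]_n * 'rV[R]_(dimw k) -> R) (phi : Z -> 'rV[R]_n) (z : Z) :
  C1 f -> {for z, continuous phi} ->
  unif_calm (fun z (w : paramw) => f (phi z, submxrow w k)) z w0.
Proof.
move=> fC1 cphi.
apply: (@unif_calm_comp _ _ _ _ _ (fun y w => f (y, w)) phi
  (fun w => submxrow w k) z w0 cphi); last exact: C1_unif_calm.
by move=> w; rewrite -submxrowB norm_submxrow_le.
Qed.

Lemma cstr_unif_calm (k : 'I_(players G)) (i : 'I_(dimu k)) :
  unif_calm (fun (z : strategies * multipliers) (w : paramw) =>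
    cstr i (submxrow z.1 k, submxrow w k)) z0 w0.
Proof.
apply: (@block_unif_calm _ k _ (cstr i) (fun z => submxrow z.1 k)).
  by case: (cstr_C2 i).
by apply: (@cvg_comp _ _ _ fst _ _ (nbhs z0.1));
  [exact: cvg_fst|exact: continuous_submxrow].
Qed.

(** Since the data are C2, the partial derivatives in the gradient formula are C1 and hence
    uniformly calm; the multipliers enter as continuous factors. *)
Lemma grad_lagrangian_unif_calm (k : 'I_(players G)) (j : 'I_(dimx k)) :
  unif_calm (fun (z : strategies * multipliers) (w : paramw) =>
    grad_lagrangian z.1 (submxrow z.2 k) (submxrow w k) 0 j) z0 w0.
Proof.
have -> : (fun (z : strategies * multipliers) (w : paramw) =>
    grad_lagrangian z.1 (submxrow z.2 k) (submxrow w k) 0 j) = fun z w =>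
    'D_(deviate 0 'e_j, 0) (@obj R G k) (z.1, submxrow w k) +
    \sum_i submxrow z.2 k 0 i *
      'D_('e_j, 0) (cstr i) (submxrow z.1 k, submxrow w k).
  by apply/funext => z; apply/funext => w; rewrite grad_lagrangianE.
have cfst : {for z0, continuous fst} by exact: cvg_fst.
have cfstk : {for z0, continuous (fun z => submxrow z.1 k)}.
  by apply: (@cvg_comp _ _ _ fst _ _ (nbhs z0.1));
    [exact: cvg_fst|exact: continuous_submxrow].
apply: unif_calmD.
  apply: (@block_unif_calm _ k _ ('D_(deviate 0 'e_j, 0) (@obj R G k)) fst).
    exact: (obj_C2 k).2.
  exact: cfst.
apply: unif_calm_sum => i; apply: unif_calmM.
  have -> : (fun z : strategies * multipliers => submxrow z.2 k 0 i) =
            (fun M : multipliers => M 0 (tagnat.Rank k i)) \o snd.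
    by apply/funext => z; rewrite /= !mxE.
  by apply: (@cvg_comp _ _ _ snd _ _ (nbhs z0.2));
    [exact: cvg_snd|exact: coord_continuous].
by apply: (@block_unif_calm _ k _ ('D_('e_j, 0) (cstr i))
  (fun z => submxrow z.1 k)) => //; exact: (cstr_C2 i).2.
Qed.

Lemma KKT_unif_calm : exists (C r : R), [/\ 0 <= C, 0 < r &
  forall z w, `|z - z0| < r -> `|w - w0| < r -> forall k : 'I_(players G),
    (forall i : 'I_(dimu k), `|cstr i (submxrow z.1 k, submxrow w k) -
      cstr i (submxrow z.1 k, submxrow w0 k)| <= C * `|w - w0|) /\
    (forall j : 'I_(dimx k),
     `|grad_lagrangian z.1 (submxrow z.2 k) (submxrow w k) 0 j -
       grad_lagrangian z.1 (submxrow z.2 k) (submxrow w0 k) 0 j|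
     <= C * `|w - w0|)].
Proof.
(* All constraints and gradient components of all players form one finite family, which yields a
   common [C] and [r]. *)
pose F (s : {k & 'I_(@dimu R G k)} + {k & 'I_(@dimx R G k)})
    (z : strategies * multipliers) (w : paramw) :=
  match s with
  | inl (existT k i) => cstr i (submxrow z.1 k, submxrow w k)
  | inr (existT k j) =>
      grad_lagrangian z.1 (submxrow z.2 k) (submxrow w k) 0 j
  end.
have [|C [r [C0 r0 CP]]] := @unif_calm_uniform R _ _ _ F z0 w0.
  by case=> -[k i]; [exact: cstr_unif_calm|exact: grad_lagrangian_unif_calm].
exists C, r; split => // z w zr wr k; split => [i|j].
  exact: (CP z w zr wr (inl (Tagged _ i))).
exact: (CP z w zr wr (inr (Tagged _ j))).
Qed.

End Data.

(** * Transfer of isolated calmness between the two mappings *)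

Theorem corollary5p1 (R : realType) (G : nep R)
    (ubar : 'rV[R]_(\sum_k @dimu R G k))
    (vbar : 'rV[R]_(\sum_k @dimx R G k))
    (wbar : 'rV[R]_(\sum_k @dimw R G k))
    (xbar : 'rV[R]_(\sum_k @dimx R G k))
    (lambar : 'rV[R]_(\sum_k @dimu R G k))
    (hbar : SKKT (ubar, vbar, wbar) (xbar, lambar)) :
  isolated_calm (@SKKT R G) (ubar, vbar, wbar) (xbar, lambar) <->
  isolated_calm (@TKKT R G wbar) (ubar, vbar) (xbar, lambar).
Proof.
split=> -[_ [kappa [U [V [kappa0 [oU Ubar] [oV Vbar] UV]]]]].
  (* The embedding of [(u, v)] as [(u, v, wbar)] preserves distances, so [kappa] and [V] are kept
     and [U] is pulled back. *)
  split=> //; exists kappa, ((fun q => (q.1, q.2, wbar)) @^-1` U), V.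
  split => //.
    split; last exact: Ubar.
    apply: open_comp oU => q _; apply: nonexpansive_continuous_at => q'.
    by rewrite !prod_normE /= subrr normr0 ge_max lexx le_max normr_ge0.
  move=> [u v] Uuv z /(UV (u, v, wbar) Uuv).
  suff -> : `|(u, v, wbar) - (ubar, vbar, wbar)| = `|(u, v) - (ubar, vbar)| by [].
  by rewrite prod_normE /= subrr normr0 max_l.
set z0 := (xbar, lambar) in Vbar UV *.
have [C [r [C0 r0 CP]]] := KKT_unif_calm z0 wbar.
have /nbhs_normP[s /= s0 sU] : nbhs (ubar, vbar) U by exact: open_nbhs_nbhs.
have C1_gt0 : 0 < 1 + C by rewrite ltr_pwDl.
(* The bound [r] keeps [w] where the estimates hold; [s / (1 + C)] puts the shifted parameters in
   [U]. *)
pose d := Num.min r (s / (1 + C)).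
have d0 : 0 < d by rewrite lt_min r0 divr_gt0.
split=> //; exists (kappa * (1 + C)), (ball (ubar, vbar, wbar) d),
  (V `&` ball z0 r).
split; first by rewrite mulr_ge0// ltW.
- by split; [exact: ball_open|exact: ballxx].
- by split; [apply: openI => //; exact: ball_open|split => //; exact: ballxx].
move=> [[u v] w] pd [x lam] [zS [zV zr]].
have {}zr : `|(x, lam) - z0| < r by move: zr; rewrite -ball_normE /= distrC.
move: pd; rewrite -ball_normE /= distrC.
set del := `|_ - (ubar, vbar, wbar)| => deld.
have [wdel udel vdel] : [/\ `|w - wbar| <= del, `|u - ubar| <= del &
    `|v - vbar| <= del].
  by rewrite /del !prod_normE /= !le_max !lexx !orbT.
have wr : `|w - wbar| < r.
  by rewrite (le_lt_trans wdel)// (lt_le_trans deld)// ge_min lexx.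
have {}CP := CP _ _ zr wr.
pose u' := u + \mxrow_k \row_i (cstr i (submxrow x k, submxrow wbar k) -
                                cstr i (submxrow x k, submxrow w k)).
pose v' := v + \mxrow_k
  (grad_lagrangian x (submxrow lam k) (submxrow wbar k) -
   grad_lagrangian x (submxrow lam k) (submxrow w k)).
have u'E k i : submxrow u' k 0 i = submxrow u k 0 i +
    (cstr i (submxrow x k, submxrow wbar k) -
     cstr i (submxrow x k, submxrow w k)).
  by rewrite submxrowD mxrowK mxE [X in _ + X]mxE.
(* The shift leaves every residual [g - u] unchanged, so feasibility and complementarity persist
   with the same multipliers. *)
have zT : TKKT wbar (u', v') (x, lam).
  move=> k; have [vE eqE ineqE] := zS k; split.
  - by rewrite submxrowD mxrowK vE addrC subrK.
  - by move=> i ik; rewrite u'E -eqE// addrC subrK.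
  move=> j jk; have [l0 gle compl] := ineqE j jk; rewrite u'E; split => //.
    by rewrite addrCA lerDl subr_ge0.
  by rewrite -[RHS]compl addrCA opprD addrA subrr sub0r opprB.
have Cdel : C * `|w - wbar| <= C * del by rewrite ler_wpM2l.
(* The [1] accounts for [u - ubar], the [C] for the correction term, bounded entrywise. *)
have u'del : `|u' - ubar| <= (1 + C) * del.
  rewrite /u' addrAC (le_trans (ler_normD _ _))// mulrDl mul1r lerD//.
  rewrite (le_trans _ Cdel)//; apply: mx_norm_le; first by rewrite mulr_ge0.
  by move=> i j; rewrite !mxE distrC; exact: (CP _).1.
have v'del : `|v' - vbar| <= (1 + C) * del.
  rewrite /v' addrAC (le_trans (ler_normD _ _))// mulrDl mul1r lerD//.
  rewrite (le_trans _ Cdel)//; apply: mx_norm_le; first by rewrite mulr_ge0.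
  move=> i j; rewrite ord1 mxE mxE [X in _ + X]mxE distrC; exact: (CP _).2.
have q'del : `|(u', v') - (ubar, vbar)| <= (1 + C) * del.
  by rewrite prod_normE /= ge_max u'del.
have q'U : U (u', v').
  apply: sU; rewrite /= distrC (le_lt_trans q'del)// mulrC -ltr_pdivlMr//.
  by rewrite (lt_le_trans deld)// ge_min lexx orbT.
have /closed_ball_imageE zle := UV _ q'U _ (conj zT zV).
have del0 : 0 <= del by exact: normr_ge0.
apply/closed_ball_imageE; first by rewrite !mulr_ge0// (ltW C1_gt0).
by rewrite -mulrA (le_trans (zle _)) ?ler_wpM2l ?mulr_ge0.
Qed.
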